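(* Across the curved rarefaction wave associated with $u-c$ emanating from the origin in the generalized Riemann problem, the entropy variation $s_x(0,\beta)$ at the singularity point satisfies, for $\beta\in[\beta_L,\beta_*]$, $$\frac{s_x(0,\beta)}{s_L'}=\frac{c_L}{c(0,\beta)}\exp\left[-\int_{\beta_L}^{\beta}\frac{1}{c(0,\xi)}\,d\xi\right]=\frac{c_L}{c(0,\beta)}\,\Pi^{-2}(c;\beta,\beta_L).$$ For polytropic gases with index $\gamma>1$, this becomes $$\frac{T s_x(0,\beta)}{T_L s_L'}=\left(\frac{c(0,\beta)}{c_L}\right)^{\frac{1}{\mu^2}+1},\qquad \mu^2=\frac{\gamma-1}{\gamma+1},$$ where $T$ is evaluated at $(0,\beta)$.
   Context: Consider the one-dimensional compressible Euler equations for density $\rho$, velocity $u$, pressure $p$: with $\mathbf u=(\rho,\rho u,\rho E)^\top$, $\mathbf f(\mathbf u)=(\rho u,\rho u^2+p,u(\rho E+p))^\top$, $E=\frac{u^2}{2}+e$, the system is $\mathbf u_t+\mathbf f(\mathbf u)_x=\mathbf G(x,\mathbf u)$, where $\mathbf G$ is a source term (external forces or geometrical effects; possibly zero) under which the entropy equation $s_t+us_x=0$ holds in smooth regions. The internal energy $e$, temperature $T$ and entropy $s$ obey the Gibbs relation $T\,ds=de-\frac{p}{\rho^2}\,d\rho$. The sound speed $c>0$ is defined by $c^2=\partial p(\rho,s)/\partial\rho$. A polytropic gas has $p=A(s)\rho^\gamma$, $c^2=\gamma p/\rho$, and $e=\frac{p}{(\gamma-1)\rho}$ proportional to $T$. Generalized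 Riemann problem (GRP): the initial data at $t=0$ are polynomial (smooth) on each side of $x=0$, with one-sided limits $\mathbf u_L,\mathbf u_R$ and one-sided first derivatives $\mathbf u_L',\mathbf u_R'$ at $x=0^\mp$; subscript $L$ denotes limits from the left and primes denote $x$-derivatives. In particular the initial entropy slope $s_L'$ is given by $T_Ls_L'=e_L'-\frac{p_L}{\rho_L^2}\rho_L'$ (ratios with $s_L'$ in the denominator are read for $s_L'\ne0$). The solution is assumed piecewise smooth near the origin, away from vacuum. As $t\to0+$ along each ray $x=at$ it tends to the self-similar solution of the classical Riemann problem for $\mathbf u_t+\mathbf f(\mathbf u)_x=0$ with data $\mathbf u_L,\mathbf u_R$. A (curved) rarefaction wave associated with the characteristic field $u-c$ emanates from the origin to the left, adjacent to the left state. Characteristic coordinates: $\alpha(x,t)=$ const and $\beta(x,t)=$ const are the integral curves of $\frac{dx}{dt}=u+c$ and $\frac{dx}{dt}=u-c$, respectively, so that, inside the rarefaction wave, $x=x(\alpha,\beta)$ and $t=t(\alpha,\beta)$ satisfy $$\frac{\partial x}{\partial\alpha}=(u-c)\frac{\partial t}{\partial\alpha},\qquad \frac{\partial x}{\partial\beta}=(u+c)\frac{\partial t}{\partial\beta}.$$ The singular point $(x,t)=(0,0)$ corresponds to $\alpha=0$, with $t(0,\beta)=0$ for all $\beta$, and $\beta$ is normalized as the wave speed at the singular point, $(u-c)(0,\beta)=\beta$. Here $\beta_L=u_L-c_L$ is the speed of the wave head and $\beta_*$ the speed of the wave tail at the origin. Flow variables are regarded as functions of $(\alpha,\beta)$,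 smooth up to $\alpha=0$ inside the wave; $(0,\beta)$ denotes the value at $\alpha=0$ (the limit at the origin along the $\beta$-characteristic), which for $u,\rho,p,c,T$ is given by the associated centered Riemann rarefaction. The derivatives $\partial(u\pm c)/\partial\alpha$ and $\partial(c\,s_x)/\partial\alpha$ are bounded near $\alpha=0$, and $\frac{\partial t}{\partial\alpha}(0,\beta)\neq0$. The quantity $s_x(0,\beta)$ is the limit of $\partial s/\partial x$ as $\alpha\to0$ at fixed $\beta$. Finally, $$\Pi(c;\beta,\beta_L):=\exp\left[\int_{\beta_L}^{\beta}\frac{1}{2c(0,\xi)}\,d\xi\right].$$ *)

(* Defs.v *)
From Stdlib Require Import Reals List.
From Coquelicot Require Import Coquelicot.
Open Scope R_scope.

(** Continuous differentiability.  A function is taken to be smooth up to the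
    boundary of a closed set when it is of class [C^n] in a neighbourhood of
    each point of that set, that is, when it is already extended across the
    boundary. *)

Definition class_C (n : nat) (f : R -> R -> R) (x y : R) : Prop :=
  locally_2d (ex_diff_n f n) x y.

Definition class_C1 (f : R -> R) (x : R) : Prop :=
  locally x (fun y => ex_derive f y /\ continuous (Derive f) y).

(** States in the variables (density, velocity, entropy). *)

Definition state : Type := (R * R * R)%type.
Definition rho (w : state) : R := fst (fst w).
Definition vel (w : state) : R := snd (fst w).
Definition ent (w : state) : R := snd w.

Definition state_class_C (n : nat) (W : R -> R -> state) (x y : R) : Prop :=
  class_C n (fun a b => rho (W a b)) x y /\
  class_C n (fun a b => vel (W a b)) x y /\
  class_C n (fun a b => ent (W a b)) x y.

Definition state_class_C1 (W : R -> state) (x : R) : Prop :=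
  class_C1 (fun y => rho (W y)) x /\
  class_C1 (fun y => vel (W y)) x /\
  class_C1 (fun y => ent (W y)) x.

(** Thermodynamics: functions of (density, entropy) on the set [phase] of
    thermodynamic states allowed for the gas. *)

Record gas := {
  phase : R -> R -> Prop;
  energy : R -> R -> R;
  pressure : R -> R -> R;
  temperature : R -> R -> R;
  sound : R -> R -> R }.

(** The differential of [energy] is the Gibbs relation
    [de = (p / r^2) dr + T ds]. *)
Definition equation_of_state (g : gas) : Prop :=
  forall r s, phase g r s ->
    locally_2d (phase g) r s /\
    0 < r /\ 0 < temperature g r s /\ 0 < sound g r s /\
    class_C 3 (energy g) r s /\
    differentiable_pt_lim (energy g) r s
      (pressure g r s / r ^ 2) (temperature g r s) /\
    is_derive (fun r' => pressure g r' s) r (sound g r s ^ 2).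

Definition polytropic (g : gas) (gamma : R) : Prop :=
  exists (A : R -> R) (Cv : R),
    forall r s, phase g r s ->
      pressure g r s = A s * Rpower r gamma /\
      sound g r s ^ 2 = gamma * pressure g r s / r /\
      energy g r s = pressure g r s / ((gamma - 1) * r) /\
      energy g r s = Cv * temperature g r s.

Section Euler.
Variable g : gas.

Definition admissible (w : state) : Prop := phase g (rho w) (ent w).
Definition e_of (w : state) : R := energy g (rho w) (ent w).
Definition p_of (w : state) : R := pressure g (rho w) (ent w).
Definition T_of (w : state) : R := temperature g (rho w) (ent w).
Definition c_of (w : state) : R := sound g (rho w) (ent w).
Definition E_of (w : state) : R := vel w ^ 2 / 2 + e_of w.

Definition cons (w : state) : R * R * R :=
  (rho w, rho w * vel w, rho w * E_of w).

Definition flux (w : state) : R * R * R :=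
  (rho w * vel w,
   rho w * vel w ^ 2 + p_of w,
   vel w * (rho w * E_of w + p_of w)).

Definition balance_law (G : R -> R * R * R -> R * R * R)
    (W : R -> R -> state) (x t : R) : Prop :=
  exists Ut Fx : R * R * R,
    is_derive (fun t' => cons (W x t')) t Ut /\
    is_derive (fun x' => flux (W x' t)) x Fx /\
    plus Ut Fx = G x (cons (W x t)).

Definition entropy_equation (W : R -> R -> state) (x t : R) : Prop :=
  Derive (fun t' => ent (W x t')) t
  + vel (W x t) * Derive (fun x' => ent (W x' t)) x = 0.

(** Rankine-Hugoniot condition for a front of speed [sigma], together with the
    requirement that the entropy of the particles crossing it does not
    decrease. *)
Definition admissible_jump (sigma : R) (wl wr : state) : Prop :=
  minus (flux wr) (flux wl) = scal sigma (minus (cons wr) (cons wl)) /\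
  0 <= rho wl * (vel wl - sigma) * (ent wr - ent wl).

(** The homogeneous equations for a solution depending only on [xi = x / t]. *)
Definition self_similar_at (RA : R -> state) (xi : R) : Prop :=
  ex_derive RA xi /\
  exists U' F' : R * R * R,
    is_derive (fun z => cons (RA z)) xi U' /\
    is_derive (fun z => flux (RA z)) xi F' /\
    F' = scal xi U'.

Definition riemann_solution (wL wR : state) (RA : R -> state) : Prop :=
  (forall xi, admissible (RA xi)) /\
  (exists l : list R,
     (forall xi, ~ In xi l -> self_similar_at RA xi) /\
     (forall xi, In xi l -> exists wl wr,
        admissible wl /\ admissible wr /\
        filterlim RA (at_left xi) (locally wl) /\
        filterlim RA (at_right xi) (locally wr) /\
        admissible_jump xi wl wr)) /\
  (exists M, (forall xi, xi < - M -> RA xi = wL) /\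
             (forall xi, M < xi -> RA xi = wR)).

(** The leftmost wave of the Riemann solution is a centered rarefaction of the
    field [u - c], occupying the rays [bL <= x / t <= bs]. *)
Definition left_centered_rarefaction
    (wL : state) (RA : R -> state) (bL bs : R) : Prop :=
  bL < bs /\ bL = vel wL - c_of wL /\
  (forall xi, xi <= bL -> RA xi = wL) /\
  continuous RA bL /\ continuous RA bs /\
  (forall xi, bL <= xi <= bs -> vel (RA xi) - c_of (RA xi) = xi) /\
  (forall xi, bL < xi < bs -> self_similar_at RA xi).

(** Piecewise smooth solutions near the origin: [N] curves [x = curve i t],
    [i < N], issue from the origin and bound [N + 1] sectors; sector [k] lies
    between the curves [k - 1] and [k].  The flow in sector [k] is [V k]. *)

Definition near_origin (d tau x t : R) : Prop := Rabs x < d /\ 0 <= t < tau.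

Definition open_sector (N : nat) (curve : nat -> R -> R) (k : nat) (x t : R)
    : Prop :=
  (forall i, (i < k)%nat -> curve i t < x) /\
  (forall i, (k <= i < N)%nat -> x < curve i t).

Definition closed_sector (N : nat) (curve : nat -> R -> R) (k : nat) (x t : R)
    : Prop :=
  (forall i, (i < k)%nat -> curve i t <= x) /\
  (forall i, (k <= i < N)%nat -> x <= curve i t).

(** Only the two outermost pieces are required to be smooth up to the origin,
    as the others may be fans. *)
Definition GRP_solution (G : R -> R * R * R -> R * R * R)
    (dL dR : R -> state) (RA : R -> state)
    (d tau : R) (N : nat) (curve : nat -> R -> R)
    (V : nat -> R -> R -> state) (W : R -> R -> state) : Prop :=
  0 < d /\ 0 < tau /\
  (forall i, (i < N)%nat ->
     curve i 0 = 0 /\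
     (forall t, 0 <= t < tau ->
        Rabs (curve i t) < d /\ class_C1 (curve i) t)) /\
  (forall i j t, (i < j < N)%nat -> 0 < t < tau -> curve i t < curve j t) /\
  (forall k x t, (k <= N)%nat -> near_origin d tau x t ->
     closed_sector N curve k x t -> 0 < t \/ k = 0%nat \/ k = N ->
     admissible (V k x t) /\ state_class_C 1 (V k) x t) /\
  (forall k x t, (k <= N)%nat -> near_origin d tau x t ->
     open_sector N curve k x t -> W x t = V k x t) /\
  (forall i t, (i < N)%nat -> 0 < t < tau ->
     W (curve i t) t = V i (curve i t) t \/
     W (curve i t) t = V (S i) (curve i t) t) /\
  (forall x, - d < x < 0 -> W x 0 = dL x) /\
  (forall x, 0 < x < d -> W x 0 = dR x) /\
  (forall k x t, (k <= N)%nat -> near_origin d tau x t -> 0 < t ->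
     open_sector N curve k x t ->
     balance_law G (V k) x t /\ entropy_equation (V k) x t) /\
  (forall i t, (i < N)%nat -> 0 < t < tau ->
     admissible_jump (Derive (curve i) t)
       (V i (curve i t) t) (V (S i) (curve i t) t)) /\
  (forall a, continuous RA a ->
     filterlim (fun t => W (a * t) t) (at_right 0) (locally (RA a))).

(** The fan is sector 1: its head is [curve 0] and its tail [curve 1], across
    which the flow is continuous. *)
Definition left_rarefaction_fan (bL bs tau : R) (N : nat)
    (curve : nat -> R -> R) (V : nat -> R -> R -> state) : Prop :=
  (2 <= N)%nat /\
  Derive (curve 0%nat) 0 = bL /\ Derive (curve 1%nat) 0 = bs /\
  (forall t, 0 < t < tau ->
     V 0%nat (curve 0%nat t) t = V 1%nat (curve 0%nat t) t /\
     V 1%nat (curve 1%nat t) t = V 2%nat (curve 1%nat t) t).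

(** The range of the coordinate [alpha] is the open interval between 0 and [a1],
    of either sign. *)
Definition alpha_range (a1 a : R) : Prop := Rmin 0 a1 < a < Rmax 0 a1.

Definition alpha_to_0 (a1 : R) : (R -> Prop) -> Prop :=
  within (alpha_range a1) (locally 0).

Definition closed_strip (a1 bL bs a b : R) : Prop :=
  (a = 0 \/ alpha_range a1 a) /\ bL <= b <= bs.

(** The [x]-derivative of the entropy of the flow [F], at the point of
    characteristic coordinates [(a, b)]. *)
Definition s_x (F : R -> R -> state) (xc tc : R -> R -> R) (a b : R) : R :=
  Derive (fun x => ent (F x (tc a b))) (xc a b).

(** [F] is the flow in the fan as a function of [(x, t)] and [Fc] the same flow
    as a function of [(alpha, beta)]. *)
Definition characteristic_coordinates
    (d tau : R) (N : nat) (curve : nat -> R -> R) (F : R -> R -> state)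
    (bL bs a1 : R) (xc tc : R -> R -> R) (Fc : R -> R -> state) : Prop :=
  a1 <> 0 /\
  (forall a b, alpha_range a1 a -> bL <= b <= bs ->
     near_origin d tau (xc a b) (tc a b) /\ 0 < tc a b /\
     closed_sector N curve 1 (xc a b) (tc a b) /\
     Fc a b = F (xc a b) (tc a b)) /\
  (forall a b a' b', alpha_range a1 a -> bL <= b <= bs ->
     alpha_range a1 a' -> bL <= b' <= bs ->
     xc a b = xc a' b' -> tc a b = tc a' b' -> a = a' /\ b = b') /\
  (exists tau', 0 < tau' /\
     forall x t, 0 < t < tau' -> closed_sector N curve 1 x t ->
       exists a b, alpha_range a1 a /\ bL <= b <= bs /\
         xc a b = x /\ tc a b = t) /\
  (forall a, alpha_range a1 a ->
     xc a bL = curve 0%nat (tc a bL) /\ xc a bs = curve 1%nat (tc a bs)) /\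
  (forall a b, closed_strip a1 bL bs a b ->
     class_C 2 xc a b /\ class_C 2 tc a b /\ state_class_C 2 Fc a b) /\
  (forall a b, closed_strip a1 bL bs a b ->
     Derive (fun a' => xc a' b) a
     = (vel (Fc a b) - c_of (Fc a b)) * Derive (fun a' => tc a' b) a /\
     Derive (fun b' => xc a b') b
     = (vel (Fc a b) + c_of (Fc a b)) * Derive (fun b' => tc a b') b) /\
  (forall b, bL <= b <= bs ->
     xc 0 b = 0 /\ tc 0 b = 0 /\
     vel (Fc 0 b) - c_of (Fc 0 b) = b /\
     Derive (fun a => tc a b) 0 <> 0) /\
  (exists eps M, 0 < eps /\
     forall a b, alpha_range a1 a -> Rabs a < eps -> bL <= b <= bs ->
     exists Dp Dm Ds,
       is_derive (fun a' => vel (Fc a' b) + c_of (Fc a' b)) a Dp /\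
       is_derive (fun a' => vel (Fc a' b) - c_of (Fc a' b)) a Dm /\
       is_derive (fun a' => c_of (Fc a' b) * s_x F xc tc a' b) a Ds /\
       Rabs Dp <= M /\ Rabs Dm <= M /\ Rabs Ds <= M).

End Euler.

Definition Pi_exp (c : R -> R) (b bL : R) : R :=
  exp (RInt (fun xi => 1 / (2 * c xi)) bL b).

(* Main.v *)
Require Import Defs.
From Stdlib Require Import Reals List Lra Lia.
From Coquelicot Require Import Coquelicot.
Open Scope R_scope.

(** In smooth flow the entropy is carried by the particles, so its slope along
    a path of speed [lambda] is [(lambda - u) s_x].  Hence, with
    [S (alpha, beta)] the entropy in characteristic coordinates and
    [H = c s_x],
      S_alpha = - H t_alpha      and      S_beta = H t_beta
    inside the fan.  The flow and the coordinates are [C^2] up to [alpha = 0],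
    so both relations can be followed to the singular point.

    At [alpha = 0] the first one is [S_alpha = - H t_alpha], with
    [H = c(0, beta) s_x(0, beta)].  In the second one [t_beta] vanishes at
    [alpha = 0], and dividing by [alpha] before passing to the limit gives
    [S_(beta alpha) = H t_(beta alpha)] there.  The symmetry of the second
    derivatives of [S] and of [t] then gives [(- H t_alpha)' = H t_alpha'],
    where primes are derivatives along [alpha = 0].  The same two limits applied
    to [x_alpha = (u - c) t_alpha] and [x_beta = (u + c) t_beta], with
    [u - c = beta], give [t_alpha + beta t_alpha' = (u + c) t_alpha'], that is
    [t_alpha = 2 c t_alpha'].  Eliminating [t_alpha] leaves the linear equation
    [H' = - H / c], whose solution is the first formula
    ([time_expansion_at_origin], [entropy_transport_at_origin]).

    The initial value is fixed on the head of the fan: it is a characteristic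
    of [u - c] lying also on the boundary of the smooth flow to the left, which
    has the same states there, so the relation for [S_alpha] holds with either
    entropy slope.  The left flow is [C^1] up to the origin and has the initial
    data as its trace at [t = 0], so its entropy slope at the origin is the
    given one, which the Gibbs relation identifies
    ([entropy_slope_at_head], [initial_entropy_slope]).

    For a polytropic gas the first two self-similar equations and [u - c = xi]
    force [u' = 2 / (gamma + 1)], so [c(0, beta)] is affine of slope
    [- mu^2]; the integral of [1 / c] is then a logarithm, and the temperature
    is proportional to [c^2]. *)

(** * Functions of two variables with continuous derivatives *)

Definition D1 (f : R -> R -> R) (x y : R) : R := Derive (fun z => f z y) x.
Definition D2 (f : R -> R -> R) (x y : R) : R := Derive (fun z => f x z) y.

Lemma class_C_D1 n f x y : class_C (S n) f x y -> class_C n (D1 f) x y.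
Proof. intros H. revert H. apply locally_2d_impl, locally_2d_forall. intros u v H. apply H. Qed.

Lemma class_C_D2 n f x y : class_C (S n) f x y -> class_C n (D2 f) x y.
Proof. intros H. revert H. apply locally_2d_impl, locally_2d_forall. intros u v H. apply H. Qed.

Lemma class_C_continuous n f x y : class_C n f x y -> continuity_2d_pt f x y.
Proof. intros H. apply locally_2d_singleton in H. destruct n; apply H. Qed.

Lemma class_C_S n f x y : class_C (S n) f x y -> class_C n f x y.
Proof.
  intros H. revert H. apply locally_2d_impl, locally_2d_forall. intros u v H.
  exact (ex_diff_n_m (S n) n (le_S _ _ (le_n n)) _ _ _ H).
Qed.

Lemma class_C_is_D1 n f x y :
  class_C (S n) f x y -> is_derive (fun z => f z y) x (D1 f x y).
Proof. intros H. apply locally_2d_singleton in H. apply Derive_correct, H. Qed.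

Lemma class_C_is_D2 n f x y :
  class_C (S n) f x y -> is_derive (fun z => f x z) y (D2 f x y).
Proof. intros H. apply locally_2d_singleton in H. apply Derive_correct, H. Qed.

Lemma class_C_mixed_partials f x y :
  class_C 2 f x y -> D2 (D1 f) x y = D1 (D2 f) x y.
Proof.
  intros H. unfold D1, D2. symmetry. apply Schwarz.
  - revert H. apply locally_2d_impl, locally_2d_forall.
    intros u v (_ & H1 & H2 & H3 & H4). repeat split; try assumption.
    + apply H4.
    + apply H3.
  - exact (class_C_continuous 0 _ _ _ (class_C_D1 0 _ _ _ (class_C_D2 1 _ _ _ H))).
  - exact (class_C_continuous 0 _ _ _ (class_C_D2 0 _ _ _ (class_C_D1 1 _ _ _ H))).
Qed.

(** Lets a limit at a point be taken along any approach, in particular along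
    [alpha -> 0] from one side. *)
Lemma continuity_2d_pt_lim {T} {F : (T -> Prop) -> Prop} {FF : Filter F}
    (f : R -> R -> R) (X Y : T -> R) (x y : R) :
  continuity_2d_pt f x y ->
  filterlim X F (locally x) -> filterlim Y F (locally y) ->
  filterlim (fun s => f (X s) (Y s)) F (locally (f x y)).
Proof.
  intros Hf HX HY. apply (proj1 (continuity_2d_pt_filterlim f x y)) in Hf.
  apply (filterlim_comp_2 (G := locally x) (H := locally y) X Y f HX HY).
  intros P HP. apply Hf in HP. destruct HP as [e He].
  exists (ball x e) (ball y e); try apply locally_ball.
  intros u v Hu Hv. apply He. split; assumption.
Qed.

Lemma class_C_continuous_1 n f x y : class_C n f x y -> continuous (fun z => f z y) x.
Proof.
  intros H. apply (continuity_2d_pt_lim f (fun z => z) (fun _ => y) x y).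
  - exact (class_C_continuous n f x y H).
  - apply filterlim_id.
  - apply filterlim_const.
Qed.

Lemma class_C_continuous_2 n f x y : class_C n f x y -> continuous (fun z => f x z) y.
Proof.
  intros H. apply (continuity_2d_pt_lim f (fun _ => x) (fun z => z) x y).
  - exact (class_C_continuous n f x y H).
  - apply filterlim_const.
  - apply filterlim_id.
Qed.

Lemma class_C_differentiable n f x y :
  class_C (S n) f x y -> differentiable_pt_lim f x y (D1 f x y) (D2 f x y).
Proof.
  intros H. apply filterdiff_differentiable_pt_lim.
  apply (is_derive_filterdiff f x y (D1 f) (D2 f x y)).
  - apply (proj1 (locally_2d_locally
      (fun u v => is_derive (fun z => f z v) u (D1 f u v)) x y)).
    revert H. apply locally_2d_impl, locally_2d_forall.
    intros u v (_ & H & _). apply Derive_correct, H.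
  - exact (class_C_is_D2 n f x y H).
  - apply (proj1 (continuity_2d_pt_filterlim (D1 f) x y)).
    exact (class_C_continuous n _ _ _ (class_C_D1 n _ _ _ H)).
Qed.

Lemma is_derive_comp_2d f X Y a lx ly X' Y' :
  differentiable_pt_lim f (X a) (Y a) lx ly ->
  is_derive X a X' -> is_derive Y a Y' ->
  is_derive (fun s => f (X s) (Y s)) a (lx * X' + ly * Y').
Proof.
  intros Hf HX HY. apply is_derive_Reals.
  apply derivable_pt_lim_comp_2d; [exact Hf| |]; now apply is_derive_Reals.
Qed.

(** * Limits of real functions along a filter *)

Lemma filterlim_Rmult {T} {F : (T -> Prop) -> Prop} {FF : Filter F} (f h : T -> R) (l m : R) :
  filterlim f F (locally l) -> filterlim h F (locally m) ->
  filterlim (fun s => f s * h s) F (locally (l * m)).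
Proof.
  intros Hf Hh. apply (filterlim_comp_2 f h Rmult Hf Hh).
  exact (filterlim_mult (K := R_AbsRing) l m).
Qed.

Lemma filterlim_Rplus {T} {F : (T -> Prop) -> Prop} {FF : Filter F} (f h : T -> R) (l m : R) :
  filterlim f F (locally l) -> filterlim h F (locally m) ->
  filterlim (fun s => f s + h s) F (locally (l + m)).
Proof.
  intros Hf Hh. apply (filterlim_comp_2 f h Rplus Hf Hh).
  exact (filterlim_plus (K := R_AbsRing) (V := R_NormedModule) l m).
Qed.

Lemma filterlim_Ropp {T} {F : (T -> Prop) -> Prop} (f : T -> R) (l : R) :
  filterlim f F (locally l) -> filterlim (fun s => - f s) F (locally (- l)).
Proof.
  intros Hf. apply (filterlim_comp _ _ _ f Ropp _ _ _ Hf).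
  exact (filterlim_opp (K := R_AbsRing) (V := R_NormedModule) l).
Qed.

Lemma filterlim_Rdiv {T} {F : (T -> Prop) -> Prop} {FF : Filter F} (f h : T -> R) (l m : R) :
  m <> 0 ->
  filterlim f F (locally l) -> filterlim h F (locally m) ->
  filterlim (fun s => f s / h s) F (locally (l / m)).
Proof.
  intros Hm Hf Hh. apply filterlim_Rmult; [exact Hf|].
  apply (filterlim_comp _ _ _ h Rinv _ _ _ Hh).
  apply (continuous_Rinv_comp (fun z => z) m); [apply continuous_id | exact Hm].
Qed.

Lemma filterlim_R_unique {T} {F : (T -> Prop) -> Prop} {FF : ProperFilter F} (f : T -> R) (l m : R) :
  filterlim f F (locally l) -> filterlim f F (locally m) -> l = m.
Proof. exact (filterlim_locally_unique (V := R_NormedModule) f l m). Qed.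

Lemma eventually_neq0 {T} {F : (T -> Prop) -> Prop} (f : T -> R) (l : R) :
  l <> 0 -> filterlim f F (locally l) -> F (fun s => f s <> 0).
Proof.
  intros Hl Hf. apply (Hf (fun z => z <> 0)).
  apply (open_neq 0 l Hl).
Qed.

(** * One-sided limits and derivatives at alpha = 0 *)

Lemma alpha_to_0_proper a1 : a1 <> 0 -> ProperFilter (alpha_to_0 a1).
Proof.
  intros Ha. split.
  - intros P [e He].
    (* [m] or [- m], according to the sign of [a1], is a point of the range. *)
    set (m := Rmin (Rabs a1) e / 2).
    assert (Hp := cond_pos e). assert (0 < Rabs a1) by now apply Rabs_pos_lt.
    assert (0 < m < Rabs a1 /\ m < e) as [Hm1 Hm2].
    { unfold m, Rmin. destruct Rle_dec; lra. }
    destruct (Rlt_or_le 0 a1) as [H0|H0].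
    + rewrite Rabs_pos_eq in Hm1 by lra. exists m. apply He.
      * change (Rabs (m - 0) < e). rewrite Rminus_0_r, Rabs_pos_eq; lra.
      * unfold alpha_range. rewrite Rmin_left, Rmax_right; lra.
    + rewrite Rabs_left in Hm1 by lra. exists (- m). apply He.
      * change (Rabs (- m - 0) < e). rewrite Rminus_0_r, Rabs_Ropp, Rabs_pos_eq; lra.
      * unfold alpha_range. rewrite Rmin_right, Rmax_left; lra.
  - unfold alpha_to_0. apply within_filter, locally_filter.
Qed.

Lemma alpha_to_0_range a1 (P : R -> Prop) : (forall a, alpha_range a1 a -> P a) -> alpha_to_0 a1 P.
Proof. intros H. exists (mkposreal 1 Rlt_0_1). intros a _. apply H. Qed.

Lemma alpha_to_0_continuous a1 (f : R -> R) : continuous f 0 -> filterlim f (alpha_to_0 a1) (locally (f 0)).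
Proof.
  intros H P HP. apply H in HP. destruct HP as [e He].
  exists e. intros a Ha _. now apply He.
Qed.

Lemma alpha_range_open a1 a : alpha_range a1 a -> locally a (alpha_range a1).
Proof.
  intros [H1 H2]. apply filter_and.
  - exact (open_gt (Rmin 0 a1) a H1).
  - exact (open_lt (Rmax 0 a1) a H2).
Qed.

Lemma alpha_range_neq0 a1 a : alpha_range a1 a -> a <> 0.
Proof.
  unfold alpha_range. intros [H1 H2] ->.
  revert H1 H2. unfold Rmin, Rmax. destruct Rle_dec; lra.
Qed.

Lemma alpha_to_0_quotient a1 (f : R -> R) l :
  is_derive f 0 l ->
  filterlim (fun a => (f a - f 0) / a) (alpha_to_0 a1) (locally l).
Proof.
  intros H P [e He]. apply is_derive_Reals in H.
  destruct (H e (cond_pos e)) as [dl Hd]. exists dl. intros a Ha Hr. apply He.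
  specialize (Hd a (alpha_range_neq0 _ _ Hr)). rewrite Rplus_0_l in Hd. apply Hd.
  change (Rabs (a - 0) < dl) in Ha. now rewrite Rminus_0_r in Ha.
Qed.

(** L'Hospital's rule read backwards: since [f / a = k (h / a)], the limit of
    [k] and the derivative of [h] determine that of [f].  A factor known
    only through its limit is what [c s_x] is at the singular point. *)
Lemma derive_at_0_of_factor a1 (f k h : R -> R) f' k0 h' :
  a1 <> 0 ->
  is_derive f 0 f' -> is_derive h 0 h' -> h 0 = 0 ->
  filterlim k (alpha_to_0 a1) (locally k0) ->
  (forall a, alpha_range a1 a -> f a = k a * h a) ->
  f' = k0 * h'.
Proof.
  intros Ha Hf Hh h0 Hk E.
  assert (PF := alpha_to_0_proper a1 Ha).
  assert (f0 : f 0 = 0).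
  { apply (filterlim_R_unique (F := alpha_to_0 a1) f).
    - apply alpha_to_0_continuous.
      exact (ex_derive_continuous f 0 (ex_intro _ _ Hf)).
    - apply (filterlim_ext_loc (fun a => k a * h a)).
      + apply alpha_to_0_range. intros a Hr. symmetry. now apply E.
      + replace 0 with (k0 * h 0) by (rewrite h0; ring).
        apply filterlim_Rmult; [exact Hk|]. apply alpha_to_0_continuous.
        exact (ex_derive_continuous h 0 (ex_intro _ _ Hh)). }
  apply (filterlim_R_unique (F := alpha_to_0 a1) (fun a => (f a - f 0) / a)).
  - now apply alpha_to_0_quotient.
  - apply (filterlim_ext_loc (fun a => k a * ((h a - h 0) / a))).
    + apply alpha_to_0_range. intros a Hr. rewrite (E a Hr), f0, h0.
      field. exact (alpha_range_neq0 _ _ Hr).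
    + apply filterlim_Rmult; [exact Hk|]. now apply alpha_to_0_quotient.
Qed.

(** Two functions differentiable at 0 that agree on one side only still have
    the same derivative: both it and the value at 0 are one-sided limits. *)
Lemma one_sided_derive_unique a1 (f h : R -> R) l m :
  a1 <> 0 ->
  (forall a, alpha_range a1 a -> f a = h a) ->
  is_derive f 0 l -> is_derive h 0 m -> l = m.
Proof.
  intros Ha E Hf Hh. assert (PF := alpha_to_0_proper a1 Ha).
  assert (E0 : f 0 = h 0).
  { apply (filterlim_R_unique (F := alpha_to_0 a1) f).
    - apply alpha_to_0_continuous, (ex_derive_continuous f 0 (ex_intro _ _ Hf)).
    - apply (filterlim_ext_loc h).
      + apply alpha_to_0_range. intros a Hr. symmetry. now apply E.
      + apply alpha_to_0_continuous, (ex_derive_continuous h 0 (ex_intro _ _ Hh)). }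
  apply (filterlim_R_unique (F := alpha_to_0 a1) (fun a => (f a - f 0) / a)).
  - now apply alpha_to_0_quotient.
  - apply (filterlim_ext_loc (fun a => (h a - h 0) / a)); [|now apply alpha_to_0_quotient].
    apply alpha_to_0_range. intros a Hr. now rewrite E, E0.
Qed.

Lemma locally_interval (P : R -> Prop) (l r b : R) :
  l < b < r -> (forall y, l < y < r -> P y) -> locally b P.
Proof.
  intros [H1 H2] H. generalize (filter_and _ _ (open_gt l b H1) (open_lt r b H2)).
  apply filter_imp. exact H.
Qed.

(** * A linear differential equation on a segment *)

Lemma constant_on_segment (f : R -> R) (a b : R) :
  a <= b ->
  (forall x, a <= x <= b -> continuous f x) ->
  (forall x, a < x < b -> is_derive f x 0) ->
  f b = f a.
Proof.
  intros Hab Hc Hd.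
  destruct (MVT_gen f a b (fun _ => 0)) as [z [_ Hz]].
  - rewrite Rmin_left, Rmax_right by lra. exact Hd.
  - rewrite Rmin_left, Rmax_right by lra. intros x Hx.
    apply continuity_pt_filterlim. now apply Hc.
  - lra.
Qed.

(** Integrating factor.  The equation is assumed in the open segment only, the
    end points being reached by continuity. *)
Lemma linear_ode_solution (f k : R -> R) (a b : R) :
  a <= b ->
  (forall x, a <= x <= b -> continuous f x) ->
  (forall x, a <= x <= b -> continuous k x) ->
  (forall x, a < x < b -> is_derive f x (- k x * f x)) ->
  f b = f a * exp (- RInt k a b).
Proof.
  intros Hab Hf Hk Hd.
  (* A continuous extension of [k] makes its primitive differentiable at the end
     points too, hence continuous on the closed segment. *)
  destruct (C0_extension_le k a b Hk) as [K [HK EK]].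
  assert (HI : forall x, is_derive (RInt K a) x (K x)).
  { intros x. apply (is_derive_RInt K _ a).
    - apply filter_forall. intros y. apply (RInt_correct K).
      apply (ex_RInt_continuous K). intros z _. apply HK.
    - apply HK. }
  rewrite (RInt_ext k K).
  2: { rewrite Rmin_left, Rmax_right by lra. intros x Hx. symmetry. apply EK. lra. }
  assert (HE : forall x, is_derive (fun y => exp (RInt K a y)) x (K x * exp (RInt K a x))).
  { intros x. apply (is_derive_comp exp (RInt K a)); [apply is_derive_exp | apply HI]. }
  assert (E : f b * exp (RInt K a b) = f a * exp (RInt K a a)).
  { apply (constant_on_segment (fun x => f x * exp (RInt K a x)) a b Hab).
    - intros x Hx. apply (filterlim_Rmult f); [now apply Hf|].
      exact (ex_derive_continuous _ x (ex_intro _ _ (HE x))).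
    - intros x Hx.
      replace 0 with (- k x * f x * exp (RInt K a x) + f x * (K x * exp (RInt K a x)))
        by (rewrite EK by lra; ring).
      apply (is_derive_mult f (fun x => exp (RInt K a x)) x (- k x * f x)
               (K x * exp (RInt K a x))); [now apply Hd | apply HE |].
      intros; apply Rmult_comm. }
  assert (E0 : RInt K a a = 0) by exact (RInt_point a K).
  rewrite E0 in E.
  rewrite exp_0, Rmult_1_r in E. rewrite <- E, Rmult_assoc, <- exp_plus, Rplus_opp_r, exp_0. ring.
Qed.

(** * Entropy transport at the singular point *)

(** The part of the geometry of the fan that determines the transport of the
    entropy.  The continuity of [c] at [alpha = 0] is a consequence of the
    relations between [x], [t], [u] and [c]. *)
Definition centered_characteristics (a1 bL bs : R) (x t u c : R -> R -> R) : Prop :=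
  a1 <> 0 /\
  (forall b, bL <= b <= bs ->
     class_C 2 x 0 b /\ class_C 2 t 0 b /\ continuity_2d_pt u 0 b) /\
  (forall a b, closed_strip a1 bL bs a b ->
     D1 x a b = (u a b - c a b) * D1 t a b /\
     D2 x a b = (u a b + c a b) * D2 t a b) /\
  (forall b, bL <= b <= bs ->
     t 0 b = 0 /\ u 0 b - c 0 b = b /\ D1 t 0 b <> 0 /\ 0 < c 0 b).

(** As [t_alpha] does not vanish at the origin, [c = u - x_alpha / t_alpha]
    expresses the sound speed through quantities continuous at [alpha = 0]. *)
Lemma sound_limit_at_origin a1 bL bs x t u c b :
  centered_characteristics a1 bL bs x t u c -> bL <= b <= bs ->
  filterlim (fun a => c a b) (alpha_to_0 a1) (locally (c 0 b)).
Proof.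
  intros (Ha & Hreg & Hch & H0) Hb.
  assert (PF := alpha_to_0_proper a1 Ha).
  destruct (Hreg b Hb) as (Hx & Ht & Hu). destruct (H0 b Hb) as (_ & _ & Htn & _).
  assert (Lt : filterlim (fun a => D1 t a b) (alpha_to_0 a1) (locally (D1 t 0 b))).
  { apply (alpha_to_0_continuous a1 (fun a => D1 t a b)).
    exact (class_C_continuous_1 _ _ _ _ (class_C_D1 1 _ _ _ Ht)). }
  assert (Lx : filterlim (fun a => D1 x a b) (alpha_to_0 a1) (locally (D1 x 0 b))).
  { apply (alpha_to_0_continuous a1 (fun a => D1 x a b)).
    exact (class_C_continuous_1 _ _ _ _ (class_C_D1 1 _ _ _ Hx)). }
  assert (Lu : filterlim (fun a => u a b) (alpha_to_0 a1) (locally (u 0 b))).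
  { apply (alpha_to_0_continuous a1 (fun a => u a b)).
    apply (continuity_2d_pt_lim u (fun a => a) (fun _ => b)); [exact Hu| |].
    - apply filterlim_id.
    - apply filterlim_const. }
  replace (c 0 b) with (u 0 b + - (D1 x 0 b / D1 t 0 b)).
  2: { destruct (Hch 0 b) as [-> _]; [split; auto|]. field. exact Htn. }
  apply (filterlim_ext_loc (fun a => u a b + - (D1 x a b / D1 t a b))).
  - generalize (filter_and _ _ (eventually_neq0 _ _ Htn Lt)
       (alpha_to_0_range a1 (alpha_range a1) (fun a H => H))).
    apply filter_imp. intros a [Hn Hr].
    destruct (Hch a b) as [-> _]; [split; auto|]. field. exact Hn.
  - apply filterlim_Rplus; [exact Lu|]. apply filterlim_Ropp.
    now apply filterlim_Rdiv.
Qed.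

(** Stated for any [sg] obeying the relation for [S_alpha], because on the head
    of the fan it is used for the entropy slopes on both sides. *)
Lemma entropy_rate_at_origin a1 bL bs x t u c (S sg : R -> R -> R) sg0 b :
  centered_characteristics a1 bL bs x t u c -> bL <= b <= bs -> class_C 1 S 0 b ->
  (forall a, alpha_range a1 a -> D1 S a b = - (c a b * sg a b) * D1 t a b) ->
  filterlim (fun a => sg a b) (alpha_to_0 a1) (locally sg0) ->
  D1 S 0 b = - (c 0 b * sg0) * D1 t 0 b.
Proof.
  intros Hc Hb HS E Hs.
  assert (Lc := sound_limit_at_origin _ _ _ _ _ _ _ b Hc Hb).
  destruct Hc as (Ha & Hreg & _ & _).
  assert (PF := alpha_to_0_proper a1 Ha).
  destruct (Hreg b Hb) as (_ & Ht & _).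
  apply (filterlim_R_unique (F := alpha_to_0 a1) (fun a => D1 S a b)).
  - apply (alpha_to_0_continuous a1 (fun a => D1 S a b)).
    exact (class_C_continuous_1 _ _ _ _ (class_C_D1 0 _ _ _ HS)).
  - apply (filterlim_ext_loc (fun a => - (c a b * sg a b) * D1 t a b)).
    + apply alpha_to_0_range. intros a Hr. symmetry. now apply E.
    + apply filterlim_Rmult.
      * apply filterlim_Ropp. now apply filterlim_Rmult.
      * apply (alpha_to_0_continuous a1 (fun a => D1 t a b)).
        exact (class_C_continuous_1 _ _ _ _ (class_C_D1 1 _ _ _ Ht)).
Qed.

(** The value of [x_(alpha beta)] at [alpha = 0] is computed twice.
    Differentiating [x_alpha = beta t_alpha] along [alpha = 0] gives
    [t_alpha + beta t_(alpha beta)]; dividing [x_beta = (u + c) t_beta] by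
    [alpha] gives [(u + c) t_(alpha beta)].  As [u - c = beta], equating
    the two gives [t_alpha = 2 c t_(alpha beta)]. *)
Lemma time_expansion_at_origin a1 bL bs x t u c b :
  centered_characteristics a1 bL bs x t u c -> bL < b < bs ->
  D2 t 0 b = 0 /\ D1 t 0 b = 2 * c 0 b * D2 (D1 t) 0 b.
Proof.
  intros Hc Hb. assert (Hb' : bL <= b <= bs) by lra.
  assert (Lc := sound_limit_at_origin _ _ _ _ _ _ _ b Hc Hb').
  destruct Hc as (Ha & Hreg & Hch & H0).
  assert (PF := alpha_to_0_proper a1 Ha).
  destruct (Hreg b Hb') as (Hx & Ht & Hu). destruct (H0 b Hb') as (_ & Hbb & _).
  assert (Ht2 : D2 t 0 b = 0).
  { unfold D2. rewrite (Derive_ext_loc _ (fun _ => 0)); [apply Derive_const|].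
    apply (locally_interval _ bL bs b Hb). intros y Hy. apply H0. lra. }
  split; [exact Ht2|].
  assert (E1 : D2 (D1 x) 0 b = D1 t 0 b + b * D2 (D1 t) 0 b).
  { apply is_derive_unique.
    apply (is_derive_ext_loc (fun y => y * D1 t 0 y)).
    - apply (locally_interval _ bL bs b Hb). intros y Hy.
      destruct (Hch 0 y) as [-> _]; [split; [auto|lra]|].
      destruct (H0 y) as (_ & -> & _); [lra|reflexivity].
    - replace (D1 t 0 b + b * D2 (D1 t) 0 b)
        with (1 * D1 t 0 b + b * D2 (D1 t) 0 b) by ring.
      apply (is_derive_mult (fun y => y) (fun y => D1 t 0 y) b 1).
      + apply is_derive_Reals, derivable_pt_lim_id.
      + exact (class_C_is_D2 0 _ _ _ (class_C_D1 1 _ _ _ Ht)).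
      + intros; apply Rmult_comm. }
  assert (E2 : D1 (D2 x) 0 b = (u 0 b + c 0 b) * D1 (D2 t) 0 b).
  { apply (derive_at_0_of_factor a1 (fun a => D2 x a b) (fun a => u a b + c a b)
      (fun a => D2 t a b)).
    - exact Ha.
    - exact (class_C_is_D1 0 _ _ _ (class_C_D2 1 _ _ _ Hx)).
    - exact (class_C_is_D1 0 _ _ _ (class_C_D2 1 _ _ _ Ht)).
    - exact Ht2.
    - apply filterlim_Rplus; [|exact Lc].
      apply (alpha_to_0_continuous a1 (fun a => u a b)).
      apply (continuity_2d_pt_lim u (fun a => a) (fun _ => b)); [exact Hu| |].
      + apply filterlim_id.
      + apply filterlim_const.
    - intros a Hr. apply Hch. split; auto. }
  rewrite <- !class_C_mixed_partials in E2 by assumption.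
  rewrite E1 in E2. nra.
Qed.

(** Continuity on both sides of each point, end points included, holds for
    [u - beta], which is [c] on the fan only. *)
Lemma inv_sound_at_origin_continuous a1 bL bs x t u c b :
  centered_characteristics a1 bL bs x t u c -> bL <= b <= bs -> continuous (fun y => 1 / (u 0 y + - y)) b.
Proof.
  intros (_ & Hreg & _ & H0) Hb. destruct (H0 b Hb) as (_ & E & _ & Hp).
  apply filterlim_Rdiv; [lra|apply filterlim_const|].
  apply (filterlim_Rplus (fun y => u 0 y)).
  - apply (continuity_2d_pt_lim u (fun _ => 0) (fun y => y)); [now apply Hreg| |].
    + apply filterlim_const.
    + apply filterlim_id.
  - apply filterlim_Ropp, filterlim_id.
Qed.

(** [H = c s_x] is represented by [- S_alpha / t_alpha], which is differentiable
    in [beta] although [s_x] itself is only known as a limit.  By the symmetry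
    of second derivatives [S_(alpha beta) = H t_(alpha beta)], so
    [H' = - 2 H t_(alpha beta) / t_alpha = - H / c]. *)
Lemma entropy_transport_at_origin a1 bL bs x t u c (S sg : R -> R -> R) (sg0 : R -> R) b :
  centered_characteristics a1 bL bs x t u c ->
  (forall b, bL <= b <= bs -> class_C 2 S 0 b) ->
  (forall a b, alpha_range a1 a -> bL <= b <= bs ->
     D1 S a b = - (c a b * sg a b) * D1 t a b) ->
  (forall a b, alpha_range a1 a -> bL < b < bs ->
     D2 S a b = c a b * sg a b * D2 t a b) ->
  (forall b, bL <= b <= bs ->
     filterlim (fun a => sg a b) (alpha_to_0 a1) (locally (sg0 b))) ->
  bL <= b <= bs ->
  c 0 b * sg0 b = c 0 bL * sg0 bL * exp (- RInt (fun z => 1 / c 0 z) bL b).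
Proof.
  intros Hc HS HS1 HS2 Hs Hb.
  assert (Hrate : forall b, bL <= b <= bs ->
    D1 S 0 b = - (c 0 b * sg0 b) * D1 t 0 b).
  { intros y Hy. apply (entropy_rate_at_origin a1 bL bs x t u c S sg (sg0 y) y Hc Hy).
    - apply class_C_S. now apply HS.
    - intros a Hr. now apply HS1.
    - now apply Hs. }
  assert (Hc' := Hc). destruct Hc' as (Ha & Hreg & Hch & H0).
  assert (PF := alpha_to_0_proper a1 Ha).
  set (H := fun y => - (D1 S 0 y / D1 t 0 y)).
  assert (HH : forall y, bL <= y <= bs -> H y = c 0 y * sg0 y).
  { intros y Hy. unfold H. rewrite (Hrate y Hy). field. now apply H0. }
  rewrite <- !HH by lra.
  rewrite (RInt_ext (fun z => 1 / c 0 z) (fun z => 1 / (u 0 z + - z))).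
  2: { rewrite Rmin_left, Rmax_right by lra. intros z Hz.
       destruct (H0 z) as (_ & E & _); [lra|]. f_equal. lra. }
  apply linear_ode_solution; [lra | | |].
  - intros y Hy. assert (Hy' : bL <= y <= bs) by lra. apply filterlim_Ropp, filterlim_Rdiv.
    + now apply H0.
    + exact (class_C_continuous_2 _ _ _ _ (class_C_D1 1 _ _ _ (HS y Hy'))).
    + exact (class_C_continuous_2 _ _ _ _ (class_C_D1 1 _ _ _ (proj1 (proj2 (Hreg y Hy'))))).
  - intros y Hy. apply (inv_sound_at_origin_continuous a1 bL bs x t u c y Hc). lra.
  - intros y Hy. assert (Hy1 : bL < y < bs) by lra. assert (Hy' : bL <= y <= bs) by lra.
    destruct (H0 y Hy') as (_ & E & Hn & Hp).
    destruct (time_expansion_at_origin _ _ _ _ _ _ _ y Hc Hy1) as [Ht2 Hexp].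
    destruct (Hreg y Hy') as (_ & Ht & _).
    assert (E2 : D2 (D1 S) 0 y = c 0 y * sg0 y * D2 (D1 t) 0 y).
    { rewrite !class_C_mixed_partials by auto.
      apply (derive_at_0_of_factor a1 (fun a => D2 S a y) (fun a => c a y * sg a y)
        (fun a => D2 t a y) (D1 (D2 S) 0 y) (c 0 y * sg0 y) (D1 (D2 t) 0 y)).
      - exact Ha.
      - exact (class_C_is_D1 0 _ _ _ (class_C_D2 1 _ _ _ (HS y Hy'))).
      - exact (class_C_is_D1 0 _ _ _ (class_C_D2 1 _ _ _ Ht)).
      - exact Ht2.
      - apply filterlim_Rmult; [|now apply Hs].
        now apply (sound_limit_at_origin a1 bL bs x t u c).
      - intros a Hr. now apply HS2. }
    replace (- (1 / (u 0 y + - y)) * H y)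
      with (- ((D2 (D1 S) 0 y * D1 t 0 y - D1 S 0 y * D2 (D1 t) 0 y) / D1 t 0 y ^ 2)).
    2: { rewrite HH, E2, Hrate by assumption.
         replace (u 0 y + - y) with (c 0 y) by lra.
         assert (D2 (D1 t) 0 y <> 0) by (intros Z; rewrite Z in Hexp; lra).
         rewrite Hexp. field. split; [lra|assumption]. }
    apply (is_derive_opp (fun y => D1 S 0 y / D1 t 0 y)).
    apply is_derive_div; [| |exact Hn].
    + exact (class_C_is_D2 0 _ _ _ (class_C_D1 1 _ _ _ (HS y Hy'))).
    + exact (class_C_is_D2 0 _ _ _ (class_C_D1 1 _ _ _ Ht)).
Qed.

(** * Entropy along paths in the flow *)

(** The chain rule with [s_t = - v s_x] and a path of speed [lam]. *)
Lemma entropy_rate_along_path (s : R -> R -> R) (v lam : R) (X Y : R -> R) (a Y' : R) :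
  class_C 1 s (X a) (Y a) ->
  D2 s (X a) (Y a) + v * D1 s (X a) (Y a) = 0 ->
  is_derive X a (lam * Y') -> is_derive Y a Y' ->
  is_derive (fun z => s (X z) (Y z)) a ((lam - v) * D1 s (X a) (Y a) * Y').
Proof.
  intros Hs E HX HY.
  replace ((lam - v) * D1 s (X a) (Y a) * Y')
    with (D1 s (X a) (Y a) * (lam * Y') + D2 s (X a) (Y a) * Y').
  2: { replace (D2 s (X a) (Y a)) with (- (v * D1 s (X a) (Y a))) by lra. ring. }
  apply is_derive_comp_2d; [|exact HX|exact HY].
  exact (class_C_differentiable 0 _ _ _ Hs).
Qed.

(** The entropy equation is imposed in the open sector; as the flow is [C^1] up
    to the boundary it extends there along the segment from an interior point
    [y], which stays in the open sector by convexity.  The head and the tail of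
    the fan, where the entropy slope must also be controlled, lie on this
    boundary. *)
Lemma entropy_equation_on_closed_sector g G dL dR RA d tau N curve V W k x y t :
  GRP_solution g G dL dR RA d tau N curve V W ->
  (k <= N)%nat -> near_origin d tau x t -> 0 < t ->
  closed_sector N curve k x t ->
  Rabs y < d -> open_sector N curve k y t ->
  entropy_equation (V k) x t.
Proof.
  intros (_ & _ & _ & _ & Hreg & _ & _ & _ & _ & Heq & _) Hk Hn Ht Hx Hy Ho.
  destruct (Hreg k x t Hk Hn Hx (or_introl Ht)) as [_ (_ & Hv & Hs)].
  set (s := fun x t => ent (V k x t)) in *.
  set (v := fun x t => vel (V k x t)) in *.
  (* [f th] is an interior point for [0 < th <= 1] and tends to [x]. *)
  set (f := fun th => x + th * (y - x)).
  assert (Hf : filterlim f (at_right 0) (locally x)).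
  { replace x with (f 0) at 1 by (unfold f; ring).
    apply (filterlim_filter_le_1 (F := locally 0)); [apply filter_le_within|].
    apply (filterlim_Rplus (fun _ => x)).
    - apply filterlim_const.
    - apply (filterlim_Rmult (fun th => th) (fun _ => y - x) 0);
        [apply filterlim_id | apply filterlim_const]. }
  change (D2 s x t + v x t * D1 s x t = 0).
  apply (filterlim_R_unique (F := at_right 0)
    (fun th => D2 s (f th) t + v (f th) t * D1 s (f th) t)).
  - assert (L : forall h, class_C 0 h x t ->
      filterlim (fun th => h (f th) t) (at_right 0) (locally (h x t))).
    { intros h Hh. apply (continuity_2d_pt_lim h f (fun _ => t)); [|exact Hf|].
      - exact (class_C_continuous 0 _ _ _ Hh).
      - apply filterlim_const. }
    apply filterlim_Rplus; [|apply filterlim_Rmult].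
    + apply (L (D2 s)), class_C_D2, Hs.
    + apply (L v), class_C_S, Hv.
    + apply (L (D1 s)), class_C_D1, Hs.
  - apply (filterlim_ext_loc (fun _ => 0)); [|apply filterlim_const].
    exists (mkposreal 1 Rlt_0_1). intros th Hth Hp.
    change (Rabs (th - 0) < 1) in Hth. rewrite Rminus_0_r, Rabs_pos_eq in Hth by lra.
    symmetry. apply (Heq k (f th) t Hk).
    + split; [|apply Hn]. destruct Hn as [Hn _].
      apply Rabs_def2 in Hn. apply Rabs_def2 in Hy. unfold f. apply Rabs_def1; nra.
    + exact Ht.
    + destruct Hx as [Hx1 Hx2]. destruct Ho as [Ho1 Ho2]. unfold f. split; intros i Hi.
      * specialize (Hx1 i Hi). specialize (Ho1 i Hi). nra.
      * specialize (Hx2 i Hi). specialize (Ho2 i Hi). nra.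
Qed.

Lemma open_sector_inhabited g G dL dR RA d tau N curve V W k t :
  GRP_solution g G dL dR RA d tau N curve V W -> (2 <= N)%nat -> (k <= 1)%nat ->
  0 < t < tau ->
  exists y, Rabs y < d /\ open_sector N curve k y t.
Proof.
  intros (_ & _ & Hc & Ho & _) HN Hk Ht.
  destruct (Hc 0%nat ltac:(lia)) as [_ H]. destruct (H t) as [H0 _]; [lra|]. clear H.
  destruct (Hc 1%nat ltac:(lia)) as [_ H]. destruct (H t) as [H1 _]; [lra|].
  apply Rabs_def2 in H0. apply Rabs_def2 in H1.
  assert (H01 := Ho 0%nat 1%nat t ltac:(lia) Ht).
  destruct k as [|[|k]]; [| |lia].
  - exists ((- d + curve 0%nat t) / 2). split; [apply Rabs_def1; lra|]. split; intros i Hi; [lia|].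
    destruct (Nat.eq_dec i 0) as [->|Hn]; [lra|].
    assert (H2 := Ho 0%nat i t ltac:(lia) Ht). lra.
  - exists ((curve 0%nat t + curve 1%nat t) / 2). split; [apply Rabs_def1; lra|]. split; intros i Hi.
    + replace i with 0%nat by lia. lra.
    + destruct (Nat.eq_dec i 1) as [->|Hn]; [lra|].
      assert (H2 := Ho 1%nat i t ltac:(lia) Ht). lra.
Qed.

(** The flow to the left of the fan coincides with the data at [t = 0] for
    negative [x] only, which suffices to identify its [x]-derivative at the
    origin; the Gibbs relation turns the energy slope into the entropy slope. *)
Lemma initial_entropy_slope g G dL dR RA d tau N curve V W sL' :
  equation_of_state g -> state_class_C1 dL 0 -> admissible g (dL 0) ->
  T_of g (dL 0) * sL'
  = Derive (fun x => e_of g (dL x)) 0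
    - p_of g (dL 0) / rho (dL 0) ^ 2 * Derive (fun x => rho (dL x)) 0 ->
  GRP_solution g G dL dR RA d tau N curve V W -> (0 < N)%nat ->
  D1 (fun x t => ent (V 0%nat x t)) 0 0 = sL'.
Proof.
  intros Hg (Hr & _ & Hs) HL HsL (Hd & Htau & Hcur & _ & Hreg & HWV & _ & HWL & _) HN.
  destruct (Hg _ _ HL) as (_ & _ & HT & _ & _ & He & _).
  apply locally_singleton in Hr. apply locally_singleton in Hs.
  assert (Dr := Derive_correct _ _ (proj1 Hr)).
  assert (Ds := Derive_correct _ _ (proj1 Hs)).
  assert (De := is_derive_comp_2d (energy g) _ _ _ _ _ _ _ He Dr Ds).
  assert (De' : Derive (fun x : R => e_of g (dL x)) 0 = _)
    by exact (is_derive_unique _ _ _ De).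
  rewrite De' in HsL.
  transitivity (Derive (fun y => ent (dL y)) 0).
  2: { unfold T_of, p_of in HsL. apply (Rmult_eq_reg_l (temperature g (rho (dL 0)) (ent (dL 0)))).
       - rewrite HsL. ring.
       - lra. }
  apply (one_sided_derive_unique (- d) (fun x => ent (V 0%nat x 0)) (fun x => ent (dL x)));
    [lra| | |exact Ds].
  - intros x Hx. unfold alpha_range in Hx. rewrite Rmin_right, Rmax_left in Hx by lra.
    rewrite <- HWL by lra. rewrite (HWV 0%nat); [reflexivity|lia| |].
    + split; [apply Rabs_def1|]; lra.
    + split; intros i Hi; [lia|]. rewrite (proj1 (Hcur i (proj2 Hi))). lra.
  - apply (class_C_is_D1 0 (fun x t => ent (V 0%nat x t))).
    apply (Hreg 0%nat 0 0); [lia| | |auto].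
    + split; [rewrite Rabs_R0|]; lra.
    + split; intros i Hi; [lia|]. rewrite (proj1 (Hcur i (proj2 Hi))). lra.
Qed.

(** * Centered rarefactions of polytropic gases *)

Lemma is_derive_fst {U V : NormedModule R_AbsRing} (f : R -> U * V) x (l : U * V) :
  is_derive f x l -> is_derive (fun y => fst (f y)) x (fst l).
Proof.
  intros H. apply (filterdiff_comp' f fst x _ fst H).
  apply filterdiff_linear, is_linear_fst.
Qed.

Lemma is_derive_snd {U V : NormedModule R_AbsRing} (f : R -> U * V) x (l : U * V) :
  is_derive f x l -> is_derive (fun y => snd (f y)) x (snd l).
Proof.
  intros H. apply (filterdiff_comp' f snd x _ snd H).
  apply filterdiff_linear, is_linear_snd.
Qed.

(** With [c = u - xi] the mass equation is [rho u' = - c rho'], and the momentum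
    equation reduces to [p' = c^2 rho'].  Since [p = c^2 rho / gamma], the
    latter reads [2 c' rho = (gamma - 1) c rho'], so
    [2 c' = - (gamma - 1) u'], the Riemann invariant; with [c' = u' - 1] this
    determines [u']. *)
Lemma polytropic_rarefaction_velocity_slope g gamma RA bL bs wL xi :
  1 < gamma -> polytropic g gamma -> equation_of_state g ->
  (forall z, admissible g (RA z)) ->
  left_centered_rarefaction g wL RA bL bs -> bL < xi < bs ->
  is_derive (fun z => vel (RA z)) xi (2 / (gamma + 1)).
Proof.
  intros Hgam (A & Cv & Hp) Hg Hadm (_ & _ & _ & _ & _ & Hspeed & Hss) Hxi.
  destruct (Hss xi Hxi) as ([w' Dw] & U' & F' & DU & DF & EF).
  change state in w'.
  assert (Dr := is_derive_fst _ _ _ (is_derive_fst _ _ _ Dw)).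
  assert (Dv := is_derive_snd _ _ _ (is_derive_fst _ _ _ Dw)).
  change (is_derive (fun z => rho (RA z)) xi (fst (fst w'))) in Dr.
  change (is_derive (fun z => vel (RA z)) xi (snd (fst w'))) in Dv.
  set (r' := fst (fst w')) in *. set (v' := snd (fst w')) in *.
  assert (DF1 := is_derive_fst _ _ _ (is_derive_fst _ _ _ DF)).
  assert (DF2 := is_derive_snd _ _ _ (is_derive_fst _ _ _ DF)).
  assert (DU1 := is_derive_fst _ _ _ (is_derive_fst _ _ _ DU)).
  assert (DU2 := is_derive_snd _ _ _ (is_derive_fst _ _ _ DU)).
  subst F'.
  change (is_derive (fun z => rho (RA z) * vel (RA z)) xi (xi * fst (fst U'))) in DF1.
  change (is_derive (fun z => rho (RA z) * vel (RA z) ^ 2 + p_of g (RA z)) xi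
            (xi * snd (fst U'))) in DF2.
  change (is_derive (fun z => rho (RA z)) xi (fst (fst U'))) in DU1.
  change (is_derive (fun z => rho (RA z) * vel (RA z)) xi (snd (fst U'))) in DU2.
  set (r := rho (RA xi)). set (v := vel (RA xi)).
  assert (E1 : r' = fst (fst U')).
  { rewrite <- (is_derive_unique _ _ _ Dr). exact (is_derive_unique _ _ _ DU1). }
  assert (Dm : is_derive (fun z => rho (RA z) * vel (RA z)) xi (r' * v + r * v')).
  { apply (is_derive_mult (fun z => rho (RA z)) (fun z => vel (RA z)) xi r' v' Dr Dv).
    intros; apply Rmult_comm. }
  assert (E2 : r' * v + r * v' = snd (fst U')).
  { rewrite <- (is_derive_unique _ _ _ Dm). exact (is_derive_unique _ _ _ DU2). }
  assert (E3 : r' * v + r * v' = xi * r').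
  { rewrite E1 at 2. rewrite <- (is_derive_unique _ _ _ Dm).
    exact (is_derive_unique _ _ _ DF1). }
  (* The momentum flux with [p] replaced by [c^2 rho / gamma] and [c] by
     [u - xi], which avoids differentiating the equation of state. *)
  assert (Dp : is_derive
     (fun z => rho (RA z) * vel (RA z) ^ 2 + (vel (RA z) - z) ^ 2 * rho (RA z) / gamma) xi
     (r' * v ^ 2 + 2 * r * v * v'
      + (2 * (v - xi) * (v' - 1) * r + (v - xi) ^ 2 * r') / gamma)).
  { unfold r, v. set (fr := fun z => rho (RA z)) in *. set (fv := fun z => vel (RA z)) in *.
    change (is_derive (fun z => fr z * fv z ^ 2 + (fv z - z) ^ 2 * fr z / gamma) xi
     (r' * fv xi ^ 2 + 2 * fr xi * fv xi * v'
      + (2 * (fv xi - xi) * (v' - 1) * fr xi + (fv xi - xi) ^ 2 * r') / gamma)).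
    auto_derive.
    - repeat split; try (eexists; eassumption).
    - replace (Derive (fun x => fr x) xi) with r' by (symmetry; now apply is_derive_unique).
      replace (Derive (fun x => fv x) xi) with v' by (symmetry; now apply is_derive_unique).
      field. lra. }
  assert (E4 : r' * v ^ 2 + 2 * r * v * v'
      + (2 * (v - xi) * (v' - 1) * r + (v - xi) ^ 2 * r') / gamma
      = xi * (r' * v + r * v')).
  { rewrite E2 at 1. rewrite <- (is_derive_unique _ _ _ DF2).
    symmetry. apply is_derive_unique. revert Dp. apply is_derive_ext_loc.
    apply (locally_interval _ bL bs xi Hxi). intros z Hz. f_equal.
    assert (Hc := Hspeed z ltac:(lra)).
    destruct (Hp _ _ (Hadm z)) as (_ & Hc2 & _).
    destruct (Hg _ _ (Hadm z)) as (_ & Hr & _).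
    replace (vel (RA z) - z) with (c_of g (RA z)) by lra.
    unfold c_of, p_of. rewrite Hc2. field. lra. }
  destruct (Hg _ _ (Hadm xi)) as (_ & Hr & _ & Hcp & _). fold r in Hr.
  assert (Hcxi := Hspeed xi ltac:(lra)). fold v in Hcxi.
  unfold c_of in Hcxi. fold r in Hcp, Hcxi. set (c := sound g r (ent (RA xi))) in *.
  assert (Ev : v = c + xi) by lra. rewrite Ev in E3, E4.
  replace (c + xi - xi) with c in E4 by ring.
  assert (Er : r * v' = - (c * r')) by lra.
  assert (E5 : 2 * (v' - 1) * r = (gamma - 1) * (c * r')).
  { apply (Rmult_eq_reg_l (c / gamma)).
    2: { apply Rgt_not_eq, Rdiv_lt_0_compat; lra. }
    transitivity (xi * (r' * (c + xi) + r * v') - r' * (c + xi) ^ 2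
       - 2 * (c + xi) * (r * v') - c ^ 2 * r' / gamma).
    - rewrite <- E4. field. lra.
    - rewrite Er. field. lra. }
  assert (E6 : v' * (gamma + 1) = 2).
  { apply (Rmult_eq_reg_r r); [|lra].
    replace (c * r') with (- (r * v')) in E5 by lra. lra. }
  assert (E7 : v' = 2 / (gamma + 1) :> R) by (apply (Rmult_eq_reg_r (gamma + 1)); [rewrite E6; field; lra | lra]).
  rewrite <- E7. exact Dv.
Qed.

Lemma polytropic_rarefaction_sound g gamma RA bL bs wL b :
  1 < gamma -> polytropic g gamma -> equation_of_state g ->
  (forall z, admissible g (RA z)) ->
  left_centered_rarefaction g wL RA bL bs -> bL <= b <= bs ->
  c_of g (RA b) = c_of g wL - (gamma - 1) / (gamma + 1) * (b - bL).
Proof.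
  intros Hgam Hpoly Hg Hadm Hrar Hb.
  assert (Hslope := fun xi => polytropic_rarefaction_velocity_slope g gamma RA bL bs wL xi
    Hgam Hpoly Hg Hadm Hrar).
  destruct Hrar as (_ & _ & HwL & HcL & Hcs & Hspeed & _).
  assert (Hv : forall y, continuous RA y -> continuous (fun z => vel (RA z)) y).
  { intros y Hy. apply (continuous_comp (fun z => fst (RA z)) snd).
    - apply (continuous_comp RA fst); [exact Hy|]. destruct (RA y). apply continuous_fst.
    - destruct (fst (RA y)). apply continuous_snd. }
  assert (E : vel (RA b) - 2 / (gamma + 1) * b = vel (RA bL) - 2 / (gamma + 1) * bL).
  { apply (constant_on_segment (fun z => vel (RA z) - 2 / (gamma + 1) * z) bL b); [lra| |].
    - intros y Hy. apply (continuous_minus (fun z => vel (RA z))).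
      + destruct (Req_dec y bL) as [->|]; [now apply Hv|].
        destruct (Req_dec y bs) as [->|]; [now apply Hv|].
        apply (ex_derive_continuous (fun z => vel (RA z))).
        eexists. apply Hslope. lra.
      + apply (ex_derive_continuous (fun z => 2 / (gamma + 1) * z)). auto_derive. exact I.
    - intros y Hy. rewrite <- (Rminus_diag (2 / (gamma + 1))).
      apply (is_derive_minus (fun z => vel (RA z))); [apply Hslope; lra|].
      assert (Hlin : is_derive (fun z => 2 / (gamma + 1) * z) y (2 / (gamma + 1)))
        by (auto_derive; [exact I | ring]).
      exact Hlin. }
  assert (S1 := Hspeed b ltac:(lra)). assert (S2 := Hspeed bL ltac:(lra)).
  rewrite (HwL bL) in S2, E by lra.
  replace ((gamma - 1) / (gamma + 1)) with (1 - 2 / (gamma + 1)) by (field; lra).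
  lra.
Qed.

(** [c^2 = gamma p / rho = gamma (gamma - 1) e], and [e] is proportional to the
    temperature; the factor is not zero because [c > 0]. *)
Lemma polytropic_temperature g gamma :
  1 < gamma -> polytropic g gamma -> equation_of_state g ->
  exists K, forall r s, phase g r s -> temperature g r s = K * sound g r s ^ 2.
Proof.
  intros Hgam (A & Cv & Hp) Hg. exists (/ (gamma * (gamma - 1) * Cv)).
  intros r s Hrs. destruct (Hp r s Hrs) as (_ & Hc & He & HT).
  destruct (Hg r s Hrs) as (_ & Hr & HTp & Hcp & _).
  assert (E : sound g r s ^ 2 = gamma * (gamma - 1) * (Cv * temperature g r s)).
  { rewrite Hc, <- HT, He. field. lra. }
  assert (Cv <> 0).
  { intros ->. assert (0 < sound g r s ^ 2) by now apply pow_lt.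
    rewrite Rmult_0_l, Rmult_0_r in E. lra. }
  rewrite E. field. repeat split; lra.
Qed.

Lemma exp_RInt_inv_affine m cL bL b :
  0 < m -> bL <= b -> 0 < cL - m * (b - bL) ->
  exp (- RInt (fun z => 1 / (cL - m * (z - bL))) bL b)
  = Rpower ((cL - m * (b - bL)) / cL) (1 / m).
Proof.
  intros Hm Hb Hpos.
  assert (Hall : forall z, bL <= z <= b -> 0 < cL - m * (z - bL)) by (intros z Hz; nra).
  assert (HcL := Hall bL ltac:(lra)). replace (cL - m * (bL - bL)) with cL in HcL by ring.
  rewrite (is_RInt_unique _ bL b
    (- (1 / m) * ln (cL - m * (b - bL)) - - (1 / m) * ln (cL - m * (bL - bL)))).
  - unfold Rpower. rewrite ln_div by assumption.
    replace (cL - m * (bL - bL)) with cL by ring. f_equal. ring.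
  - apply (is_RInt_derive (fun z => - (1 / m) * ln (cL - m * (z - bL)))).
    + rewrite Rmin_left, Rmax_right by lra. intros z Hz. specialize (Hall z Hz).
      auto_derive; [assumption|]. field. lra.
    + rewrite Rmin_left, Rmax_right by lra. intros z Hz. specialize (Hall z Hz).
      apply (ex_derive_continuous (fun z => 1 / (cL - m * (z - bL)))).
      auto_derive. lra.
Qed.

(** * The entropy in the fan and on its head *)

Lemma entropy_rate_in_sector g G dL dR RA d tau N curve V W k (X Y : R -> R) a lam Y' :
  GRP_solution g G dL dR RA d tau N curve V W -> (2 <= N)%nat -> (k <= 1)%nat ->
  near_origin d tau (X a) (Y a) -> 0 < Y a -> closed_sector N curve k (X a) (Y a) ->
  is_derive X a (lam * Y') -> is_derive Y a Y' ->
  is_derive (fun z => ent (V k (X z) (Y z))) a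
    ((lam - vel (V k (X a) (Y a))) * D1 (fun x t => ent (V k x t)) (X a) (Y a) * Y').
Proof.
  intros HW HN Hk Hn Ht Hcl HX HY.
  destruct (open_sector_inhabited _ _ _ _ _ _ _ _ _ _ _ k (Y a) HW HN Hk)
    as (y & Hy & Ho); [split; [exact Ht | apply Hn]|].
  apply (entropy_rate_along_path (fun x t => ent (V k x t))); [| |exact HX|exact HY].
  - destruct HW as (_ & _ & _ & _ & Hreg & _). apply (Hreg k); auto. lia.
  - apply (entropy_equation_on_closed_sector _ _ _ _ _ _ _ _ _ _ _ k _ y _ HW); auto. lia.
Qed.

Lemma fan_centered_characteristics g dL dR RA d tau N curve V bL bs a1 xc tc Fc :
  equation_of_state g ->
  riemann_solution g (dL 0) (dR 0) RA ->
  characteristic_coordinates g d tau N curve (V 1%nat) bL bs a1 xc tc Fc ->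
  (forall b, bL <= b <= bs -> Fc 0 b = RA b) ->
  centered_characteristics a1 bL bs xc tc (fun a b => vel (Fc a b)) (fun a b => c_of g (Fc a b)).
Proof.
  intros Hg [Hadm _] (Ha & _ & _ & _ & _ & Hreg & Hch & H0 & _) HFc.
  split; [exact Ha|]. split; [|split; [exact Hch|]].
  - intros b Hb. destruct (Hreg 0 b) as (Hx & Ht & _ & Hv & _); [split; auto|].
    split; [exact Hx|]. split; [exact Ht|]. exact (class_C_continuous 2 _ _ _ Hv).
  - intros b Hb. destruct (H0 b Hb) as (_ & Ht & Hs & Hn). repeat split; auto.
    rewrite (HFc b Hb). apply (Hg _ _ (Hadm b)).
Qed.

(** The curves [beta = const] have speed [u - c], which is [- c] relative to
    the particles. *)
Lemma fan_entropy_alpha g G dL dR RA d tau N curve V W bL bs a1 xc tc Fc a b :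
  characteristic_coordinates g d tau N curve (V 1%nat) bL bs a1 xc tc Fc ->
  GRP_solution g G dL dR RA d tau N curve V W -> (2 <= N)%nat ->
  alpha_range a1 a -> bL <= b <= bs ->
  D1 (fun a b => ent (Fc a b)) a b
  = - (c_of g (Fc a b) * s_x (V 1%nat) xc tc a b) * D1 tc a b.
Proof.
  intros (_ & HF & _ & _ & _ & Hreg & Hch & _) HW HN Hr Hb.
  destruct (HF a b Hr Hb) as (Hn & Ht & Hcl & E).
  destruct (Hreg a b) as (Hx & Htc & _); [split; auto|].
  destruct (Hch a b) as (Hch1 & _); [split; auto|].
  apply is_derive_unique.
  apply (is_derive_ext_loc (fun z => ent (V 1%nat (xc z b) (tc z b)))).
  { generalize (alpha_range_open a1 a Hr). apply filter_imp.
    intros z Hz. destruct (HF z b Hz Hb) as (_ & _ & _ & Ez). now rewrite Ez. }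
  replace (- (c_of g (Fc a b) * s_x (V 1%nat) xc tc a b) * D1 tc a b)
    with ((vel (Fc a b) - c_of g (Fc a b) - vel (Fc a b)) * s_x (V 1%nat) xc tc a b
          * D1 tc a b) by ring.
  rewrite E at 3.
  apply (entropy_rate_in_sector _ _ _ _ _ _ _ _ _ _ _ 1 (fun z => xc z b) (fun z => tc z b)
    a _ _ HW HN); auto.
  - assert (HX := class_C_is_D1 1 _ _ _ Hx). unfold D1 in HX. rewrite Hch1 in HX. exact HX.
  - exact (class_C_is_D1 1 _ _ _ Htc).
Qed.

(** The curves [alpha = const] have speed [u + c].  At a point of the head or
    of the tail such a curve lies in the fan on one side only, so interior values
    of [beta] are taken. *)
Lemma fan_entropy_beta g G dL dR RA d tau N curve V W bL bs a1 xc tc Fc a b :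
  characteristic_coordinates g d tau N curve (V 1%nat) bL bs a1 xc tc Fc ->
  GRP_solution g G dL dR RA d tau N curve V W -> (2 <= N)%nat ->
  alpha_range a1 a -> bL < b < bs ->
  D2 (fun a b => ent (Fc a b)) a b
  = c_of g (Fc a b) * s_x (V 1%nat) xc tc a b * D2 tc a b.
Proof.
  intros (_ & HF & _ & _ & _ & Hreg & Hch & _) HW HN Hr Hb.
  assert (Hb' : bL <= b <= bs) by lra.
  destruct (HF a b Hr Hb') as (Hn & Ht & Hcl & E).
  destruct (Hreg a b) as (Hx & Htc & _); [split; auto|].
  destruct (Hch a b) as (_ & Hch2); [split; auto|].
  apply is_derive_unique.
  apply (is_derive_ext_loc (fun z => ent (V 1%nat (xc a z) (tc a z)))).
  { apply (locally_interval _ bL bs b Hb). intros z Hz.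
    destruct (HF a z Hr ltac:(lra)) as (_ & _ & _ & Ez). now rewrite Ez. }
  replace (c_of g (Fc a b) * s_x (V 1%nat) xc tc a b * D2 tc a b)
    with ((vel (Fc a b) + c_of g (Fc a b) - vel (Fc a b)) * s_x (V 1%nat) xc tc a b
          * D2 tc a b) by ring.
  rewrite E at 3.
  apply (entropy_rate_in_sector _ _ _ _ _ _ _ _ _ _ _ 1 (fun z => xc a z) (fun z => tc a z)
    b _ _ HW HN); auto.
  - assert (HX := class_C_is_D2 1 _ _ _ Hx). unfold D2 in HX. rewrite Hch2 in HX. exact HX.
  - exact (class_C_is_D2 1 _ _ _ Htc).
Qed.

(** The head [beta = bL] is at once a curve of the fan and the boundary of the
    flow to its left; the states agree on it, so the entropy along it may be
    followed in the left flow. *)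
Lemma head_entropy_alpha g G dL dR RA d tau N curve V W bL bs a1 xc tc Fc a :
  characteristic_coordinates g d tau N curve (V 1%nat) bL bs a1 xc tc Fc ->
  GRP_solution g G dL dR RA d tau N curve V W ->
  left_rarefaction_fan bL bs tau N curve V -> bL <= bs ->
  alpha_range a1 a ->
  D1 (fun a b => ent (Fc a b)) a bL
  = - (c_of g (Fc a bL) * D1 (fun x t => ent (V 0%nat x t)) (xc a bL) (tc a bL))
    * D1 tc a bL.
Proof.
  intros (_ & HF & _ & _ & Hhead & Hreg & Hch & _) HW (HN & _ & _ & Hfan) Hbb Hr.
  assert (Hb : bL <= bL <= bs) by lra.
  assert (EV : forall z, alpha_range a1 z -> Fc z bL = V 0%nat (xc z bL) (tc z bL)).
  { intros z Hz. destruct (HF z bL Hz Hb) as (Hn & Ht & _ & ->).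
    destruct (Hhead z Hz) as [-> _]. symmetry. apply Hfan. split; [exact Ht|apply Hn]. }
  destruct (HF a bL Hr Hb) as (Hn & Ht & _ & _).
  destruct (Hreg a bL) as (Hx & Htc & _); [split; auto|].
  destruct (Hch a bL) as (Hch1 & _); [split; auto|].
  apply is_derive_unique.
  apply (is_derive_ext_loc (fun z => ent (V 0%nat (xc z bL) (tc z bL)))).
  { generalize (alpha_range_open a1 a Hr). apply filter_imp.
    intros z Hz. now rewrite EV. }
  set (sx := D1 (fun x t => ent (V 0%nat x t)) (xc a bL) (tc a bL)).
  replace (- (c_of g (Fc a bL) * sx) * D1 tc a bL)
    with ((vel (Fc a bL) - c_of g (Fc a bL) - vel (Fc a bL)) * sx * D1 tc a bL) by ring.
  rewrite (EV a Hr) at 3.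
  apply (entropy_rate_in_sector _ _ _ _ _ _ _ _ _ _ _ 0 (fun z => xc z bL) (fun z => tc z bL)
    a _ _ HW HN); auto.
  - destruct (Hhead a Hr) as [-> _]. split; intros i Hi; [lia|].
    destruct (Nat.eq_dec i 0) as [->|Hi0]; [lra|].
    destruct HW as (_ & _ & _ & Hord & _). destruct Hn as [_ Hn].
    assert (H := Hord 0%nat i (tc a bL) ltac:(lia) ltac:(lra)). lra.
  - assert (HX := class_C_is_D1 1 _ _ _ Hx). unfold D1 in HX. rewrite Hch1 in HX. exact HX.
  - exact (class_C_is_D1 1 _ _ _ Htc).
Qed.

(** Both expressions of the entropy rate along the head have a limit at the
    origin, and the common factor [c t_alpha] is not zero there. *)
Lemma entropy_slope_at_head g G dL dR RA d tau N curve V W bL bs a1 xc tc Fc sx0 :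
  equation_of_state g ->
  riemann_solution g (dL 0) (dR 0) RA ->
  characteristic_coordinates g d tau N curve (V 1%nat) bL bs a1 xc tc Fc ->
  GRP_solution g G dL dR RA d tau N curve V W ->
  left_rarefaction_fan bL bs tau N curve V -> bL <= bs ->
  (forall b, bL <= b <= bs -> Fc 0 b = RA b) ->
  filterlim (fun a => s_x (V 1%nat) xc tc a bL) (alpha_to_0 a1) (locally sx0) ->
  sx0 = D1 (fun x t => ent (V 0%nat x t)) 0 0.
Proof.
  intros Hg HRA Hc HW Hfan Hbb HFc Hsx.
  assert (Hch := fan_centered_characteristics _ _ _ _ _ _ _ _ _ _ _ _ _ _ _ Hg HRA Hc HFc).
  assert (Hb : bL <= bL <= bs) by lra.
  assert (Hc' := Hc). destruct Hc' as (Ha & _ & _ & _ & _ & Hreg & _ & H0 & _).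
  assert (PF := alpha_to_0_proper a1 Ha).
  destruct (Hreg 0 bL) as (Hx & Ht & _ & _ & Hs); [split; auto|].
  destruct (H0 bL Hb) as (Ex & Et & _ & _).
  set (S := fun a b => ent (Fc a b)) in *. set (s0 := fun x t => ent (V 0%nat x t)).
  assert (R1 := entropy_rate_at_origin a1 bL bs _ _ _ _ S (s_x (V 1%nat) xc tc) sx0 bL
    Hch Hb (class_C_S 1 _ _ _ Hs)
    (fun a Hr => fan_entropy_alpha _ _ _ _ _ _ _ _ _ _ _ _ _ _ _ _ _ a bL Hc HW
       (proj1 Hfan) Hr Hb) Hsx).
  assert (L0 : filterlim (fun a => D1 s0 (xc a bL) (tc a bL)) (alpha_to_0 a1)
                 (locally (D1 s0 0 0))).
  { apply (continuity_2d_pt_lim (D1 s0) (fun a => xc a bL) (fun a => tc a bL)).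
    - apply (class_C_continuous 0), class_C_D1.
      destruct HW as (Hd & Htau & Hcur & _ & HV & _). apply (HV 0%nat 0 0); [lia| | |auto].
      + split; [rewrite Rabs_R0|]; lra.
      + split; intros i Hi; [lia|]. rewrite (proj1 (Hcur i (proj2 Hi))). lra.
    - rewrite <- Ex. apply (alpha_to_0_continuous a1 (fun a => xc a bL)).
      exact (class_C_continuous_1 _ _ _ _ Hx).
    - rewrite <- Et. apply (alpha_to_0_continuous a1 (fun a => tc a bL)).
      exact (class_C_continuous_1 _ _ _ _ Ht). }
  assert (R2 := entropy_rate_at_origin a1 bL bs _ _ _ _ S
    (fun a b => D1 s0 (xc a b) (tc a b)) (D1 s0 0 0) bL
    Hch Hb (class_C_S 1 _ _ _ Hs)
    (fun a Hr => head_entropy_alpha _ _ _ _ _ _ _ _ _ _ _ _ _ _ _ _ _ a Hc HW Hfan Hbb Hr)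
    L0).
  destruct Hch as (_ & _ & _ & Hch0). destruct (Hch0 bL Hb) as (_ & _ & Hn & Hp).
  rewrite R1 in R2. apply (Rmult_eq_reg_r (D1 tc 0 bL)) in R2; [|exact Hn].
  apply (Rmult_eq_reg_l (c_of g (Fc 0 bL))); lra.
Qed.

Theorem proposition3p3
  (g : gas) (Hg : equation_of_state g)
  (G : R -> R * R * R -> R * R * R)
  (* initial data on the two sides, extended through x = 0 *)
  (dL dR : R -> state)
  (HdL : state_class_C1 dL 0) (HdR : state_class_C1 dR 0)
  (HL : admissible g (dL 0)) (HR : admissible g (dR 0))
  (* initial entropy slope *)
  (sL' : R)
  (HsL : T_of g (dL 0) * sL'
         = Derive (fun x => e_of g (dL x)) 0
           - p_of g (dL 0) / rho (dL 0) ^ 2 * Derive (fun x => rho (dL x)) 0)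
  (HsL0 : sL' <> 0)
  (* associated Riemann problem *)
  (RA : R -> state) (bL bs : R)
  (HRA : riemann_solution g (dL 0) (dR 0) RA)
  (Hrar : left_centered_rarefaction g (dL 0) RA bL bs)
  (* solution of the generalized Riemann problem *)
  (d tau : R) (N : nat) (curve : nat -> R -> R)
  (V : nat -> R -> R -> state) (W : R -> R -> state)
  (HW : GRP_solution g G dL dR RA d tau N curve V W)
  (Hfan : left_rarefaction_fan bL bs tau N curve V)
  (* characteristic coordinates in the fan *)
  (a1 : R) (xc tc : R -> R -> R) (Fc : R -> R -> state)
  (Hc : characteristic_coordinates g d tau N curve (V 1%nat)
          bL bs a1 xc tc Fc)
  (HFc : forall b, bL <= b <= bs -> Fc 0 b = RA b)
  (* entropy variation at the singularity *)
  (sx0 : R -> R)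
  (Hsx0 : forall b, bL <= b <= bs ->
     filterlim (fun a => s_x (V 1%nat) xc tc a b)
       (alpha_to_0 a1) (locally (sx0 b))) :
  let cL := c_of g (dL 0) in
  let c0 := fun b => c_of g (Fc 0 b) in
  (forall b, bL <= b <= bs ->
     sx0 b / sL' = cL / c0 b * exp (- RInt (fun xi => 1 / c0 xi) bL b) /\
     cL / c0 b * exp (- RInt (fun xi => 1 / c0 xi) bL b)
     = cL / c0 b * powerRZ (Pi_exp c0 b bL) (-2)) /\
  (forall gamma, 1 < gamma -> polytropic g gamma ->
     let mu2 := (gamma - 1) / (gamma + 1) in
     forall b, bL <= b <= bs ->
       T_of g (Fc 0 b) * sx0 b / (T_of g (dL 0) * sL')
       = Rpower (c0 b / cL) (1 / mu2 + 1)).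
Proof.
  intros cL c0.
  assert (Hrar' := Hrar). destruct Hrar' as (Hbb & _ & HwL & _).
  assert (Hadm := proj1 HRA). assert (HN := proj1 Hfan).
  assert (Hch := fan_centered_characteristics _ _ _ _ _ _ _ _ _ _ _ _ _ _ _ Hg HRA Hc HFc).
  assert (EL : c0 bL = cL).
  { unfold c0, cL. rewrite HFc, HwL by lra. reflexivity. }
  assert (Hpos : forall b, bL <= b <= bs -> 0 < c0 b) by (intros b Hb; now apply Hch).
  assert (HcL : 0 < cL) by (rewrite <- EL; apply Hpos; lra).
  assert (EsL : sx0 bL = sL').
  { rewrite (entropy_slope_at_head _ _ _ _ _ _ _ _ _ _ _ _ _ _ _ _ _ (sx0 bL)
      Hg HRA Hc HW Hfan (Rlt_le _ _ Hbb) HFc (Hsx0 bL ltac:(lra))).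
    apply (initial_entropy_slope _ _ _ _ _ _ _ _ _ _ _ _ Hg HdL HL HsL HW). lia. }
  assert (Main : forall b, bL <= b <= bs ->
     sx0 b / sL' = cL / c0 b * exp (- RInt (fun xi => 1 / c0 xi) bL b)).
  { intros b Hb.
    assert (E := entropy_transport_at_origin a1 bL bs _ _ _ _ (fun a b => ent (Fc a b))
      (s_x (V 1%nat) xc tc) sx0 b Hch).
    assert (E' : c0 b * sx0 b = c0 bL * sx0 bL * exp (- RInt (fun xi => 1 / c0 xi) bL b)).
    { apply E; [| | |exact Hsx0|exact Hb].
      - intros y Hy. destruct Hc as (_ & _ & _ & _ & _ & Hreg & _).
        apply (Hreg 0 y). split; auto.
      - intros a y Hr Hy. apply (fan_entropy_alpha _ _ _ _ _ _ _ _ _ _ _ _ _ _ _ _ _ a y Hc HW HN Hr Hy).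
      - intros a y Hr Hy. apply (fan_entropy_beta _ _ _ _ _ _ _ _ _ _ _ _ _ _ _ _ _ a y Hc HW HN Hr Hy). }
    rewrite EL, EsL in E'. specialize (Hpos b Hb).
    replace (sx0 b) with (c0 b * sx0 b / c0 b) by (field; lra).
    rewrite E'. field. lra. }
  split.
  - intros b Hb. split; [now apply Main|]. f_equal.
    unfold Pi_exp. rewrite (RInt_ext (fun xi => 1 / (2 * c0 xi)) (fun xi => / 2 * (1 / c0 xi))).
    2: { rewrite Rmin_left, Rmax_right by lra. intros z Hz.
         assert (Hz' := Hpos z ltac:(lra)).
         change (1 / (2 * c0 z) = / 2 * (1 / c0 z) :> R). field. lra. }
    assert (EI : RInt (fun xi => / 2 * (1 / c0 xi)) bL b = / 2 * RInt (fun xi => 1 / c0 xi) bL b).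
    { apply (RInt_scal (V := R_CompleteNormedModule)).
      (* [u - beta] replaces [c]: it is continuous across the end points. *)
      apply (ex_RInt_ext (fun z => 1 / (vel (Fc 0 z) + - z))).
      - rewrite Rmin_left, Rmax_right by lra. intros z Hz.
        destruct Hch as (_ & _ & _ & H0). destruct (H0 z) as (_ & E & _); [lra|].
        fold (c0 z) in E. f_equal. lra.
      - apply (ex_RInt_continuous (V := R_CompleteNormedModule)).
        rewrite Rmin_left, Rmax_right by lra. intros z Hz.
        apply (inv_sound_at_origin_continuous _ _ _ _ _ _ _ z Hch). lra. }
    rewrite EI. set (J := RInt _ bL b). simpl powerRZ.
    rewrite Rmult_1_r, <- exp_plus, <- exp_Ropp. f_equal. lra.
  - intros gamma Hgam Hpoly mu2 b Hb.
    assert (Hmu : 0 < mu2) by (unfold mu2; apply Rdiv_lt_0_compat; lra).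
    assert (Hsound : forall y, bL <= y <= bs -> c0 y = cL - mu2 * (y - bL)).
    { intros y Hy. unfold c0. rewrite (HFc y Hy).
      exact (polytropic_rarefaction_sound g gamma RA bL bs (dL 0) y Hgam Hpoly Hg Hadm Hrar Hy). }
    destruct (polytropic_temperature g gamma Hgam Hpoly Hg) as [K HK].
    assert (HTL : T_of g (dL 0) = K * cL ^ 2) by apply (HK _ _ HL).
    assert (HTb : T_of g (Fc 0 b) = K * c0 b ^ 2).
    { unfold c0. rewrite (HFc b Hb). apply (HK _ _ (Hadm b)). }
    assert (HTp : 0 < T_of g (dL 0)) by apply (Hg _ _ HL).
    assert (HK0 : K <> 0) by (intros ->; lra).
    specialize (Main b Hb). assert (Hcb := Hpos b Hb).
    rewrite (RInt_ext _ (fun z => 1 / (cL - mu2 * (z - bL)))) in Main.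
    2: { rewrite Rmin_left, Rmax_right by lra. intros z Hz. rewrite Hsound by lra. reflexivity. }
    rewrite exp_RInt_inv_affine in Main; [|exact Hmu|lra|rewrite <- Hsound; lra].
    rewrite <- Hsound in Main by lra.
    rewrite Rpower_plus, Rpower_1 by (apply Rdiv_lt_0_compat; lra).
    rewrite HTb, HTL.
    transitivity (c0 b ^ 2 / cL ^ 2 * (sx0 b / sL')); [field; repeat split; lra|].
    rewrite Main. field. lra.
Qed.
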